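(* For every ultrafilter order $\leq_{\mathcal{U}}^{\mathcal{D}}$ on the Knaster continuum $K$, the set $M=\{(x,y)\in K^2:x\leq_{\mathcal{U}}^{\mathcal{D}}y\}$ is a non-analytic and non-co-analytic subset of $K^2$. In particular, for every ultrafilter order $\leq_{\mathcal{U}}^{\mathcal{D}}$ on $K$, the set $M$ is a non-Borel subset of $K^2$.
   Context: A continuum is a compact connected metrizable space; fix a metric generating its topology. A chain in $X$ is a finite sequence of open sets $d_1,\dots,d_k$ (its links) with $d_i\cap d_j\neq\varnothing\iff|i-j|\le 1$; its mesh is the maximum of the diameters of its links. $X$ is chainable if for every $\varepsilon>0$ it is covered by a chain of mesh less than $\varepsilon$. $\mathbb{N}=\{1,2,3,\dots\}$. Let $\mathcal{D}=\{D_n\}_{n\in\mathbb{N}}$ be a sequence of chains $D_n=\{d_{1,n},\dots,d_{k_n,n}\}$, each covering $X$, with $\mathrm{mesh}(D_n)\to 0$, and let $\mathcal{U}$ be a non-principal ultrafilter on $\mathbb{N}$. Write $x\leq_{D_n}y$ iff there exist $i\le j\le k_n$ with $x\in d_{i,n}$ and $y\in d_{j,n}$, and $x\leq_{\mathcal{U}}^{\mathcal{D}}y$ iff $\{n\in\mathbb{N}: x\leq_{D_n}y\}\in\mathcal{U}$. This is a linear order on $X$. An ultrafilter order on $X$ is any order of the form $\leq_{\mathcal{U}}^{\mathcal{D}}$ for some such $\mathcal{D}$ and $\mathcal{U}$. Let $\mathcal{C}\subseteq[0,1]\times\{0\}$ be the standard Cantor ternary set. The Knaster continuum is the (chainable)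 subspace $K$ of $\mathbb{R}^2$ consisting of: all semicircles with ordinates $\ge0$, with center $(\frac12,0)$, passing through points of $\mathcal{C}$; and, for each $n\ge1$, all semicircles with ordinates $\le0$, with center $(\frac{5}{2\cdot3^n},0)$, passing through points of $\mathcal{C}$ lying in the interval $[\frac{2}{3^n},\frac{1}{3^{n-1}}]$. *)

(* Defs.v *)
From mathcomp Require Import all_boot all_order all_algebra.
From mathcomp Require Import all_classical all_reals all_analysis.

Set Implicit Arguments.
Unset Strict Implicit.
Unset Printing Implicit Defensive.

Import Order.TTheory GRing.Theory Num.Theory.
Import numFieldTopology.Exports.

Local Open Scope classical_set_scope.
Local Open Scope ring_scope.

Section Metrics.
Context {R : realType} {X : topologicalType}.
Implicit Types (d : X -> X -> R) (A : set X).

Definition is_metric d : Prop :=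
  [/\ forall x y, 0 <= d x y,
      forall x y, d x y = 0 <-> x = y,
      forall x y, d x y = d y x
    & forall x y z, d x z <= d x y + d y z].

Definition compatible_metric d : Prop :=
  is_metric d /\
  forall A, open A <->
    forall x, A x -> exists2 e, 0 < e & forall y, d x y < e -> A y.

Definition complete_metric d : Prop :=
  forall u : nat -> X,
    (forall e, 0 < e -> exists N, forall m n,
       (N <= m)%N -> (N <= n)%N -> d (u m) (u n) < e) ->
    exists l : X, forall e, 0 < e -> exists N, forall n,
       (N <= n)%N -> d (u n) l < e.

(* The value is -oo on the empty set; the links of a chain are nonempty. *)
Definition diameter d A : \bar R :=
  ereal_sup [set (d p.1 p.2)%:E | p in A `*` A].

Definition mesh d (k : nat) (D : 'I_k -> set X) : \bar R :=
  \big[maxe/0%E]_(i < k) diameter d (D i).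

End Metrics.

Section DescriptiveSets.

Definition polish (R : realType) (Y : topologicalType) : Prop :=
  (exists d : Y -> Y -> R, compatible_metric d /\ complete_metric d) /\
  (exists2 S : set Y, countable S & dense S).

(* [R] is only the field in which metrics take their values.  The carrier of
   a [topologicalType] may be empty, so [set0] is analytic. *)
Definition analytic (R : realType) (X : topologicalType) (A : set X) : Prop :=
  exists (Y : topologicalType) (f : Y -> X),
    [/\ polish R Y, continuous f & range f = A].

Definition coanalytic (R : realType) (X : topologicalType) (A : set X) : Prop :=
  analytic R (~` A).

Definition borel_set (X : topologicalType) (A : set X) : Prop :=
  <<s [set U : set X | open U] >> A.

End DescriptiveSets.

Section UltrafilterOrders.
Context {R : realType} {X : topologicalType}.

Definition is_chain (k : nat) (D : 'I_k -> set X) : Prop :=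
  (forall i, open (D i)) /\
  (forall i j, D i `&` D j !=set0 <-> (`|i%:Z - j%:Z| <= 1)%N).

Definition covers (k : nat) (D : 'I_k -> set X) : Prop :=
  \bigcup_i D i = [set: X].

Definition chain_le (k : nat) (D : 'I_k -> set X) (x y : X) : Prop :=
  exists i j : 'I_k, [/\ (i <= j)%N, D i x & D j y].

Definition nonprincipal (U : set_system nat) : Prop := forall n, ~ U [set n].

Definition ultra_le (k : nat -> nat) (D : forall n, 'I_(k n) -> set X)
  (U : set_system nat) (x y : X) : Prop :=
  U [set n | chain_le (D n) x y].

(* Sequences of chains and ultrafilters are indexed by [nat], i.e. from 0. *)
Definition ultrafilter_order (d : X -> X -> R) (le : X -> X -> Prop) : Prop :=
  exists (k : nat -> nat) (D : forall n, 'I_(k n) -> set X)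
         (U : set_system nat),
    [/\ forall n, is_chain (D n) /\ covers (D n),
        mesh d (D n) @[n --> \oo] --> 0%E,
        UltraFilter U,
        nonprincipal U
      & forall x y, le x y <-> ultra_le D U x y].

End UltrafilterOrders.

Section Knaster.
Variable R : realType.

Fixpoint cantor_stage (n : nat) : set R :=
  if n is m.+1 then
    [set x / 3 | x in cantor_stage m] `|` [set (x + 2) / 3 | x in cantor_stage m]
  else `[0, 1].

Definition cantor_ternary : set R := \bigcap_n cantor_stage n.

(* Half-circles centered at (a, 0) and passing through (c, 0). *)
Definition upper_semicircle (a c : R) : set (R * R) :=
  [set p | 0 <= p.2 /\ (p.1 - a) ^+ 2 + p.2 ^+ 2 = (c - a) ^+ 2].

Definition lower_semicircle (a c : R) : set (R * R) :=
  [set p | p.2 <= 0 /\ (p.1 - a) ^+ 2 + p.2 ^+ 2 = (c - a) ^+ 2].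

Definition knaster_set : set (R * R) :=
  (\bigcup_(c in cantor_ternary) upper_semicircle (1 / 2) c) `|`
  (\bigcup_(n in [set n | (1 <= n)%N])
    \bigcup_(c in cantor_ternary `&` `[2 / 3 ^+ n, 1 / 3 ^+ n.-1])
      lower_semicircle (5 / (2 * 3 ^+ n)) c).

(* A [set_type] carries the subspace topology. *)
Definition knaster : topologicalType := set_type knaster_set.

End Knaster.

(* Main.v *)
Require Import Defs.
From mathcomp Require Import all_boot all_order all_algebra.
From mathcomp Require Import all_classical all_reals all_analysis.
From mathcomp Require Import lra zify.

Set Implicit Arguments.
Unset Strict Implicit.
Unset Printing Implicit Defensive.

Import Order.TTheory GRing.Theory Num.Theory.
Import numFieldTopology.Exports.

Local Open Scope classical_set_scope.
Local Open Scope ring_scope.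

(** Every ultrafilter order on the Knaster continuum lacks the Baire property on
    a copy of the Cantor set, whereas analytic sets, their complements and Borel
    sets have it.

    The order cannot see inside a composant from the outside.  If a subcontinuum
    [A] misses a point [y], then in a chain of small mesh no link around [y]
    meets [A], so that [A] lies entirely before or entirely after [y]
    ([chain_cut], [ultra_le_connected]).  Therefore, as long as [x] and [y] lie
    in different composants, whether [x] precedes [y] depends on their composants
    only.

    On the Cantor set [C], which the continuum crosses, composants are described
    by ternary digits.  An upper semicircle joins [c] to [1 - c], whose digits
    are all reflected; a lower one joins [c] to [5 / 3 ^ n - c], where the digits
    after the first nonzero one are reflected.  Following these arcs as in a
    reflected Gray code, one can travel between any two points of [C] with the
    same digits from some place on ([flips_eventually_equal],
    [eventually_equal_arc_linked]), while meeting only points of [C] whose tail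
    of digits agrees with the given one up to reflection.

    So, apart from the meager set of pairs with equal or reflected tails, the
    order restricted to [C] is a subset of the square of [C] that is invariant
    under finite changes of digits in either coordinate.  If it had the Baire
    property, it would be meager or comeager ([zero_one_law]).  But the exchange
    of coordinates maps the order to its converse; the two cover the square and
    meet only on the diagonal, which contradicts Baire's theorem
    ([tail_invariant_order_not_baire]).

    That continuous preimages of analytic sets have the Baire property is
    [analytic_preimage_baire_property]. *)

(** * Meager sets and the Baire property *)

Section Category.
Context {T : topologicalType}.
Implicit Types A B U : set T.

(** Equivalent to the closure having empty interior, in the form in which
    Baire's theorem uses it. *)
Definition nowhere_dense B := forall U, open U -> U !=set0 ->
  exists U', [/\ open U', U' !=set0, U' `<=` U & U' `&` B `<=` set0].

Definition meager A := exists F : nat -> set T,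
  (forall n, nowhere_dense (F n)) /\ A `<=` \bigcup_n F n.

Definition baire_property A := exists U,
  [/\ open U, meager (A `\` U) & meager (U `\` A)].

Lemma nowhere_dense0 : nowhere_dense set0.
Proof. by move=> U oU U0; exists U; split=> // x []. Qed.

Lemma nowhere_dense_meager B : nowhere_dense B -> meager B.
Proof. by move=> ndB; exists (fun=> B); split=> // x Bx; exists 0%N. Qed.

Lemma sub_meager A B : A `<=` B -> meager B -> meager A.
Proof.
by move=> AB [F [ndF BF]]; exists F; split=> //; exact: subset_trans BF.
Qed.

Lemma meager_bigcup (I : countType) (A : I -> set T) :
  (forall i, meager (A i)) -> meager (\bigcup_i A i).
Proof.
move=> /choice[G GP].
exists (fun n => if unpickle n is Some (i, k) then G i k else set0); split.
  move=> n; case: unpickle => [[i k]|]; last exact: nowhere_dense0.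
  exact: (GP i).1.
move=> x [i _ Aix]; have [k _ Gikx] := (GP i).2 _ Aix.
by exists (pickle (i, k)) => //; rewrite pickleK.
Qed.

Lemma meagerU A B : meager A -> meager B -> meager (A `|` B).
Proof.
move=> mA mB.
apply: (@sub_meager _ (\bigcup_b if b then A else B)); last first.
  by apply: meager_bigcup => -[].
by move=> x [?|?]; [exists true|exists false].
Qed.

(** Inside an open set that meets [U], shrink to [U]; an open set that misses
    [U] lies in the interior of the complement. *)
Lemma nowhere_dense_frontier U :
  open U -> nowhere_dense (~` U `\` (~` U)^°).
Proof.
move=> oU V oV V0; have [[x [Ux Vx]]|UV0] := pselect (U `&` V !=set0).
  exists (U `&` V); split=> //; [exact: openI|by exists x|].
  by move=> y [[Uy _] []].
exists V; split=> // x [Vx [_]]; apply; rewrite /interior /= nbhsE.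
by exists V => // y Vy Uy; apply: UV0; exists y.
Qed.

Lemma open_baire_property U : open U -> baire_property U.
Proof.
move=> oU; exists U; rewrite setDv; split=> //;
  exact/nowhere_dense_meager/nowhere_dense0.
Qed.

Lemma baire_propertyC A : baire_property A -> baire_property (~` A).
Proof.
move=> [U [oU mAU mUA]]; exists (~` U)^°; split; first exact: open_interior.
- apply: sub_meager (meagerU mUA
    (nowhere_dense_meager (nowhere_dense_frontier oU))) => x [nAx nUx].
  by have [Ux|Ux] := pselect (U x); [left|right].
- by apply: sub_meager mAU => x [/interior_subset nUx /contrapT Ax].
Qed.

Lemma baire_property_bigcup (A : nat -> set T) :
  (forall n, baire_property (A n)) -> baire_property (\bigcup_n A n).
Proof.
move=> /choice[U UP]; exists (\bigcup_n U n); split.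
- by apply: bigcup_open => n _; case: (UP n).
- apply: sub_meager (meager_bigcup (A := fun n => A n `\` U n) _).
    by move=> x [[n _ Ax] nUx]; exists n => //; split=> // Ux; apply: nUx; exists n.
  by move=> n; case: (UP n).
- apply: sub_meager (meager_bigcup (A := fun n => U n `\` A n) _).
    by move=> x [[n _ Ux] nAx]; exists n => //; split=> // Ax; apply: nAx; exists n.
  by move=> n; case: (UP n).
Qed.

Lemma baire_property_bigcap (A : nat -> set T) :
  (forall n, baire_property (A n)) -> baire_property (\bigcap_n A n).
Proof.
move=> bA; rewrite -[X in baire_property X]setCK setC_bigcap.
by apply/baire_propertyC/baire_property_bigcup => n; exact/baire_propertyC/bA.
Qed.

Lemma baire_propertyI A B :
  baire_property A -> baire_property B -> baire_property (A `&` B).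
Proof.
move=> bA bB; have -> : A `&` B = \bigcap_n (if n is 0%N then A else B).
  apply/seteqP; split=> [x [? ?] [|n] _ //|x ABx].
  by split; [exact: (ABx 0%N)|exact: (ABx 1%N)].
by apply: baire_property_bigcap => -[].
Qed.

Lemma baire_property_meager A : meager A -> baire_property A.
Proof.
move=> mA; exists set0; split; first exact: open0.
- by rewrite setD0.
- by rewrite set0D; exact/nowhere_dense_meager/nowhere_dense0.
Qed.

Lemma preimage_involution_meager (f : T -> T) A :
  continuous f -> involutive f -> meager A -> meager (f @^-1` A).
Proof.
move=> cf ff [F [ndF AF]]; exists (fun n => f @^-1` F n); split; last first.
  by move=> x /AF[n _ Fx]; exists n.
have pre V : open V -> open (f @^-1` V) by move=> oV; exact: open_comp.
move=> n U oU [x Ux].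
have [|U' [oU' [y U'y] U'U U'F]] := ndF n (f @^-1` U) (pre _ oU).
  by exists (f x); rewrite /= ff.
exists (f @^-1` U'); split; [exact: pre|by exists (f y); rewrite /= ff| |].
- by move=> z /U'U; rewrite /= ff.
- by move=> z; exact: U'F.
Qed.

(** The union of the open sets in which [A] is meager: outside of it, every
    neighbourhood of a point meets [A] in a non-meager set. *)
Definition light A := \bigcup_(U in [set U | open U /\ meager (U `&` A)]) U.

Lemma open_light A : open (light A).
Proof. by apply: bigcup_open => U []. Qed.

(** With a countable base, countably many open sets suffice to form the
    union. *)
Lemma meager_light A : @second_countable T -> meager (light A `&` A).
Proof.
move=> [S /countable_injP[f finj] [So Sb]].
pose G n := \bigcup_(V in [set V | [/\ S V, f V = n & meager (V `&` A)]]) (V `&` A).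
apply: (@sub_meager _ (\bigcup_n G n)).
  move=> x [[U [oU mU] Ux] Ax].
  have [V [SV Vx] VO] : filter_from [set U | S U /\ U x] id U.
    by apply: Sb; exact: open_nbhs_nbhs.
  exists (f V) => //; exists V => //; split=> //.
  by apply: sub_meager mU => y [/VO].
apply: meager_bigcup => n.
have [[V [SV fVn mV]]|nV] :=
    pselect (exists V, [/\ S V, f V = n & meager (V `&` A)]).
  apply: sub_meager mV => x [W [SW fWn _] Wx].
  by rewrite (finj V W) ?inE// fVn fWn.
apply: sub_meager (nowhere_dense_meager nowhere_dense0) => x [V VP Vx].
by apply: nV; exists V.
Qed.

(** A set with the Baire property that meets [A] in a meager set is, up to a
    meager set, an open set of that kind, hence nearly contained in
    [light A]. *)
Lemma meager_setD_light A E :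
  baire_property E -> meager (E `&` A) -> meager (E `\` light A).
Proof.
move=> [U [oU mEU mUE]] mEA; apply: sub_meager mEU => x [Ex nlx].
split=> // Ux; apply: nlx; exists U => //; split=> //.
apply: sub_meager (meagerU mUE mEA) => y [Uy Ay].
by have [Ey|Ey] := pselect (E y); [right|left].
Qed.

End Category.

(** * Analytic sets have the Baire property *)

Lemma borel_preimage_baire_property (Z T : topologicalType) (g : Z -> T)
    (A : set T) :
  continuous g -> borel_set A -> baire_property (g @^-1` A).
Proof.
move=> cg; apply: (@smallest_sub _ _ _ [set B | baire_property (g @^-1` B)]).
  split=> [|B bB|B bB] /=.
  - by rewrite preimage_set0; exact/open_baire_property/open0.
  - by rewrite setTD; exact: baire_propertyC bB.
  - by rewrite preimage_bigcup; exact: baire_property_bigcup.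
by move=> V oV; apply: open_baire_property; exact: open_comp.
Qed.

(** A Souslin-scheme argument.  [piece s] is the part of the Polish space [Y]
    lying within [2 ^- k] of a prescribed point of the dense set for each
    [k < size s], the latest index coming first, and [shadow s] is the part of
    the preimage contributed by it.  Deleting the countably many meager sets
    [hole s], a point outside [light (shadow [::])] stays outside
    [light (shadow s)] along some infinite branch.  The pieces of the branch
    shrink to a point of [Y], whose image must be the given one. *)
Lemma analytic_preimage_baire_property (R : realType) (Z T : topologicalType)
    (g : Z -> T) (A : set T) :
  @second_countable Z -> hausdorff_space T -> continuous g ->
  analytic R A -> baire_property (g @^-1` A).
Proof.
move=> scZ hT cg [Y [f [[[d [[md dtop] dcompl]] [S cS denseS]] cf <-]]].
have [dge0 d0 dsym dtri] := md.
have /countable_injP[idx idx_inj] := cS.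
pose r k : R := 2^-1 ^+ k.
have r_gt0 k : 0 < r k by rewrite exprn_gt0// invr_gt0.
have r_le j k : (j <= k)%N -> r k <= r j.
  by move=> jk; apply: ler_wiXn2l => //; rewrite ?invr_ge0//; lra.
have r_small e : 0 < e -> exists k, r k < e.
  move=> e0.
  have /cvgrPdist_lt/(_ _ e0) : @GRing.exp R 2^-1 @ \oo --> (0 : R).
    by apply: cvg_expr; rewrite ger0_norm ?invr_ge0//; lra.
  case=> N _ /(_ N (leqnn N)); rewrite sub0r normrN ger0_norm ?ltW//.
  by exists N.
pose ball_ n k : set Y := [set y | exists q, [/\ S q, idx q = n & d q y < r k]].
have ball_dist n k y y' : ball_ n k y -> ball_ n k y' -> d y y' < r k + r k.
  move=> [q [Sq qn dqy]] [q' [Sq' qn' dqy']].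
  move: dqy'; rewrite -(idx_inj q q') ?inE ?qn// => dqy'.
  by apply: le_lt_trans (dtri _ q _) _; rewrite (dsym y q) ltrD.
have ball_cover k y : exists n, ball_ n k y.
  have oB : open [set z | d y z < r k].
    apply/dtop => z /= yz; exists (r k - d y z); first by rewrite subr_gt0.
    by move=> w zw; apply: le_lt_trans (dtri _ z _) _; rewrite -ltrBrDl.
  have [|q [/= yq Sq]] := denseS _ _ oB.
    by exists y => /=; rewrite (d0 y y).2.
  by exists (idx q), q; split=> //; rewrite dsym.
pose piece := fix piece s : set Y :=
  if s is n :: s' then piece s' `&` ball_ n (size s') else setT.
pose shadow s : set Z := [set z | exists2 y, piece s y & f y = g z].
pose hole s := (\bigcap_n light (shadow (n :: s))) `\` light (shadow s).
have meager_hole s : meager (hole s).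
  apply: meager_setD_light.
    by apply: baire_property_bigcap => n; exact/open_baire_property/open_light.
  apply: sub_meager (meager_bigcup (A := fun n =>
      light (shadow (n :: s)) `&` shadow (n :: s)) _); last first.
    by move=> n; exact: meager_light.
  move=> z [lz [y py fy]]; have [n yn] := ball_cover (size s) y.
  by exists n => //; split; [exact: lz|exists y].
have -> : g @^-1` range f = shadow [::].
  by apply/seteqP; split=> [z [y _ fy]|z [y _ fy]]; exists y.
(* up to meager sets the preimage is the complement of [light (shadow [::])];
   the interior of that closed set is an open witness *)
exists (~` closure (light (shadow [::]))); split.
- exact/closed_openC/closed_closure.
- pose L := light (shadow [::]); have oL : open L by exact: open_light.
  apply: sub_meager (meagerU (meager_light (shadow [::]) scZ)
    (nowhere_dense_meager (nowhere_dense_frontier oL))) => z [sz /contrapT clz].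
  have [lz|nlz] := pselect (L z); first by left.
  by right; split=> //; rewrite interiorC.
- apply: sub_meager (meager_bigcup meager_hole) => z [nclz nsz].
  apply: contrapT => nohole.
  have nlz : ~ light (shadow [::]) z by move=> lz; apply: nclz; exact: subset_closure.
  have step s : exists n, ~ light (shadow s) z -> ~ light (shadow (n :: s)) z.
    apply: contrapT => nn; apply: nohole; exists s => //.
    split=> [n _|lz].
      by apply: contrapT => ln; apply: nn; exists n.
    by apply: nn; exists 0%N.
  have [next nextP] := choice step.
  pose branch k := iter k (fun s => next s :: s) [::].
  have branch_light k : ~ light (shadow (branch k)) z.
    by elim: k => // k IH; exact: nextP.
  have size_branch k : size (branch k) = k by elim: k => //= k ->.
  have branch_near k (U : set Z) : open U -> U z ->
      exists z' y, [/\ U z', piece (branch k) y & f y = g z'].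
    move=> oU Uz; apply: contrapT => nex; apply: (branch_light k).
    exists U => //; split=> //.
    apply: sub_meager (nowhere_dense_meager nowhere_dense0).
    by move=> z' [Uz' [y py fy]]; apply: nex; exists z', y.
  have piece_mono j k : (j <= k)%N -> piece (branch k) `<=` piece (branch j).
    move=> /subnK <-; elim: (k - j)%N => // m IH y [py _]; exact: IH.
  have piece_dist k y y' : piece (branch k.+1) y -> piece (branch k.+1) y' ->
      d y y' < r k + r k.
    by move=> [_ By] [_ By']; rewrite -(size_branch k); exact: ball_dist By By'.
  have /choice[u uP] k : exists y, piece (branch k.+1) y.
    by have [_ [y [_ py _]]] := branch_near k.+1 setT openT I; exists y.
  have [|y yP] := dcompl u.
    move=> e e0; have [N rN] := r_small (e / 2) (divr_gt0 e0 (ltr0n _ 2)).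
    exists N => m n Nm Nn; apply: (@lt_trans _ _ (r N + r N)); last by lra.
    apply: piece_dist; first exact: (piece_mono N.+1 m.+1 Nm _ (uP m)).
    exact: (piece_mono N.+1 n.+1 Nn _ (uP n)).
  apply: nsz; exists y => //; apply: contrapT => /eqP fygz.
  move: hT; rewrite open_hausdorff => /(_ _ _ fygz).
  move=> [[V W] /= [/set_mem Vy /set_mem Wz] [oV oW /eqP VW0]].
  have /dtop/(_ _ Vy)[e e0 eV] : open (f @^-1` V) by exact: open_comp.
  have [k rk] := r_small (e / 4) (divr_gt0 e0 (ltr0n _ 4)).
  have [N uN] := yP (r k) (r_gt0 k).
  have oW' : open (g @^-1` W) by exact: open_comp.
  have [z' [y' [Wz' py' fy']]] := branch_near k.+1 _ oW' Wz.
  have : (V `&` W) (f y').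
    split; last by rewrite fy'.
    apply: eV; pose m := maxn N k.
    apply: le_lt_trans (dtri _ (u m) _) _; rewrite (dsym y).
    have h1 := uN m (leq_maxl _ _).
    have h2 : d (u m) y' < r k + r k.
      apply: piece_dist => //.
      exact: (piece_mono k.+1 m.+1 (leq_maxr _ _) _ (uP m)).
    lra.
  by rewrite VW0.
Qed.

(** * The zero-one law on the Cantor space *)

Definition cylinder (x : cantor_space) n : set cantor_space :=
  [set z | forall i, (i < n)%N -> z i = x i].

Definition eventually_equal (x y : cantor_space) :=
  exists n, forall i, (n <= i)%N -> x i = y i.

Definition toggle (s : seq nat) (x : cantor_space) : cantor_space :=
  fun i => x i (+) (i \in s).

Lemma nbhs_cylinder (x : cantor_space) (U : set cantor_space) :
  nbhs x U -> exists n, cylinder x n `<=` U.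
Proof.
pose F := filter_from [set: nat] (cylinder x).
have FF : Filter F.
  apply: filter_from_filter; first by exists 0%N.
  move=> m n _ _; exists (maxn m n) => // z zx; split=> i im; apply: zx.
    by rewrite (leq_trans im) ?leq_maxl.
  by rewrite (leq_trans im) ?leq_maxr.
suff /(_ U) FU : F --> x by move=> /FU[n _]; exists n.
apply/cvg_sup => i V [/= W [[B _ BW] Wx] WV].
exists i.+1 => // z zx; apply: WV; rewrite -BW /=.
by rewrite zx ?ltnS//; rewrite -BW in Wx.
Qed.

Lemma eval_continuous i : continuous (fun x : cantor_space => x i).
Proof. exact: (@proj_continuous nat (fun=> bool) i). Qed.

Lemma open_cylinder x n : open (cylinder x n).
Proof.
elim: n => [|n IH].
  by rewrite (_ : cylinder x 0 = setT); [exact: openT|apply/seteqP; split].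
have -> : cylinder x n.+1 =
    cylinder x n `&` (fun z : cantor_space => z n) @^-1` [set x n].
  apply/seteqP; split=> z.
    by move=> zx; split=> [i lin|]; apply: zx; rewrite // ltnS ltnW.
  by move=> [zx zn] i; rewrite ltnS leq_eqVlt => /orP[/eqP->//|]; exact: zx.
apply: openI => //; apply: open_comp; last exact: discrete_open.
by move=> z _; exact: eval_continuous.
Qed.

Lemma continuous_cylinder (f : cantor_space -> cantor_space) :
  (forall x n, exists m, forall z, cylinder x m z -> cylinder (f x) n (f z)) ->
  continuous f.
Proof.
move=> fP x U /nbhs_cylinder[n nU]; have [m mP] := fP x n.
rewrite /= nbhsE; exists (cylinder x m); last by move=> z /mP/nU.
by split=> //; exact: open_cylinder.
Qed.

Lemma cantor_second_countable : @second_countable cantor_space.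
Proof.
pose B : set (set cantor_space) :=
  range (fun s : seq bool => cylinder (nth false s) (size s)).
exists B; first exact: sub_countable (card_image_le _ _) (countableP _).
split=> [_ [s _ <-]|x U /nbhs_cylinder[n nU]]; first exact: open_cylinder.
exists (cylinder x n) => //; split=> //; exists (mkseq x n) => //.
rewrite size_mkseq; apply/seteqP; split=> z zx i lin.
  by rewrite zx ?nth_mkseq.
by rewrite zx ?nth_mkseq.
Qed.

(** Baire's theorem: extend a cylinder so that it avoids the first nowhere
    dense set, then the second, and so on. *)
Lemma cantor_not_meager : ~ meager [set: cantor_space].
Proof.
move=> [F [ndF FT]].
have step (k : nat) (c : cantor_space * nat) : exists c' : cantor_space * nat,
    [/\ (c.2 < c'.2)%N, cylinder c'.1 c'.2 `<=` cylinder c.1 c.2 &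
        cylinder c'.1 c'.2 `&` F k `<=` set0].
  have [|V [oV [z Vz] Vc VF]] := ndF k _ (open_cylinder c.1 c.2).
    by exists c.1.
  have [n nV] : exists n, cylinder z n `<=` V.
    by apply: nbhs_cylinder; exact: open_nbhs_nbhs.
  exists (z, maxn n c.2.+1) => /=.
  have sub : cylinder z (maxn n c.2.+1) `<=` V.
    move=> y yz; apply: nV => i lin; apply: yz.
    by rewrite (leq_trans lin) ?leq_maxl.
  split; first by rewrite leq_maxr.
    by apply: subset_trans sub _.
  by move=> y [/sub Vy Fy]; apply: (VF y).
(* the second component grows, so the entry of index [i] is settled from the
   stage [i.+1] on *)
have [next nextP] := choice (fun kc => step kc.1 kc.2).
pose c := fix c k := if k is k'.+1 then next (k', c k') else (fun=> false, 0%N).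
have c_long k : (k <= (c k).2)%N.
  elim: k => // k IH; apply: leq_ltn_trans IH _.
  by have [] := nextP (k, c k).
have c_mono j k : (j <= k)%N ->
    cylinder (c k).1 (c k).2 `<=` cylinder (c j).1 (c j).2.
  move=> /subnK <-; elim: (k - j)%N => // m IH y cy; apply: IH.
  by have [_ sub _] := nextP ((m + j)%N, c (m + j)%N); exact: sub.
pose z : cantor_space := fun i => (c i.+1).1 i.
have zc k : cylinder (c k).1 (c k).2 z.
  move=> i lik; have [le|/ltnW le] := leqP i.+1 k.
    have ck : cylinder (c k).1 (c k).2 (c k).1 by [].
    have := c_mono _ _ le _ ck i; rewrite /z => -> //; exact: c_long.
  have ci : cylinder (c i.+1).1 (c i.+1).2 (c i.+1).1 by [].
  by apply: (c_mono _ _ le _ ci).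
have [k _ Fkz] := FT z I.
by have [_ _ /(_ z)] := nextP (k, c k); apply; split=> //; exact: (zc k.+1).
Qed.

Lemma toggleK s : involutive (toggle s).
Proof. by move=> x; apply/funext => i; rewrite /toggle -addbA addbb addbF. Qed.

Lemma toggle_continuous s : continuous (toggle s).
Proof.
apply: continuous_cylinder => x n; exists n => z zx i lin.
by rewrite /toggle zx.
Qed.

Lemma toggle_eventually_equal s x : eventually_equal (toggle s x) x.
Proof.
exists (\max_(i <- s) i).+1 => i ltsi; rewrite /toggle.
suff /negbTE -> : i \notin s by rewrite addbF.
by apply: contraL ltsi => si; rewrite -leqNgt; apply: leq_bigmax_seq.
Qed.

(** If [A] is comeager in a nonempty open set [U], the countably many finite
    modifications carry [U] over the whole space. *)
Lemma zero_one_law (A : set cantor_space) :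
  baire_property A ->
  (forall x y, eventually_equal x y -> A x -> A y) ->
  meager A \/ meager (~` A).
Proof.
move=> [U [oU mAU mUA]] invA.
have [[x Ux]|U0] := pselect (U !=set0); last first.
  left; apply: sub_meager mAU => x Ax; split=> // Ux; apply: U0; by exists x.
right; have [n nU] : exists n, cylinder x n `<=` U.
  by apply: nbhs_cylinder; exact: open_nbhs_nbhs.
apply: sub_meager (meager_bigcup (A := fun s => toggle s @^-1` (U `\` A)) _).
  move=> z nAz; exists [seq i <- iota 0 n | z i != x i] => //; split.
    apply: nU => i lin; rewrite /toggle mem_filter mem_iota leq0n add0n lin andbT.
    by case: (z i); case: (x i).
  by move=> Az; apply: nAz; apply: invA Az; exact: toggle_eventually_equal.
move=> s; apply: preimage_involution_meager mUA; first exact: toggle_continuous.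
exact: toggleK.
Qed.

(** * Tails of binary sequences *)

Definition flip_from n (x : cantor_space) : cantor_space :=
  fun i => x i (+) (n <= i)%N.

(** Tails are compared up to reflection of all digits, because each passage
    through a semicircle reflects the tail. *)
Definition tail_class (x y : cantor_space) :=
  exists n b, forall i, (n <= i)%N -> x i = b (+) y i.

Lemma tail_class_refl x : tail_class x x.
Proof. by exists 0%N, false. Qed.

Lemma tail_class_sym x y : tail_class x y -> tail_class y x.
Proof. by move=> [n [b xy]]; exists n, b => i /xy ->; rewrite addKb. Qed.

Lemma tail_class_trans x y z :
  tail_class x y -> tail_class y z -> tail_class x z.
Proof.
move=> [m [b xy]] [n [c yz]]; exists (maxn m n), (b (+) c) => i mni.
by rewrite xy ?yz ?addbA ?(leq_trans _ mni) ?leq_maxl ?leq_maxr.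
Qed.

Lemma tail_class_flip n x : tail_class x (flip_from n x).
Proof.
exists n, true => i ni.
by rewrite /flip_from ni addbC -addbA addbb addbF.
Qed.

Lemma eventually_equal_tail_class x y : eventually_equal x y -> tail_class x y.
Proof. by move=> [n xy]; exists n, false => i /xy. Qed.

(** A reflected Gray code.  Starting from a sequence that vanishes below
    [n.+1], flipping it from [n] on, then from [n.+1] on, then from [n] on again
    amounts to flipping it from [n.+1] on; so, by induction, [P] allows every
    flip [flip_from n] of a sequence that vanishes below [n].  These flips erase
    the nonzero entries one after the other. *)
Lemma flips_eventually_equal (P : cantor_space -> cantor_space -> Prop) :
  (forall x, P x x) -> (forall x y, P x y -> P y x) ->
  (forall x y z, P x y -> P y z -> P x z) ->
  (forall x, P x (flip_from 0 x)) ->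
  (forall x n, (forall i, (i < n)%N -> x i = false) -> x n ->
     P x (flip_from n.+1 x)) ->
  forall x y, eventually_equal x y -> P x y.
Proof.
move=> Prefl Psym Ptrans Pupper Plower.
have flipP n x : (forall i, (i < n)%N -> x i = false) -> P x (flip_from n x).
  elim: n x => [|n IH] x x0; first exact: Pupper.
  pose y := flip_from n x.
  have y0 i : (i < n)%N -> y i = false.
    by move=> lin; rewrite /y /flip_from (ltn_geF lin) addbF x0// ltnW.
  have yn : y n by rewrite /y /flip_from leqnn x0.
  apply: (Ptrans _ y); first by apply: IH => i lin; apply: x0; rewrite ltnW.
  apply: (Ptrans _ (flip_from n.+1 y)); first exact: Plower.
  have -> : flip_from n.+1 x = flip_from n (flip_from n.+1 y).
    apply/funext => i; rewrite /y /flip_from.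
    by case: (n <= i)%N; case: (n < i)%N; case: (x i).
  apply: IH => i lin.
  by rewrite /flip_from y0// addFb (leq_gtF (ltnW lin)).
have eraseP n x : P x (fun i => (n <= i)%N && x i).
  elim: n => [|n IH]; first exact: Prefl.
  pose z : cantor_space := fun i => (n <= i)%N && x i.
  apply: (Ptrans _ z) => //.
  have z0 i : (i < n)%N -> z i = false by rewrite /z => /ltn_geF ->.
  have [zn|zn] := boolP (z n); last first.
    rewrite (_ : (fun i => _) = z); first exact: Prefl.
    apply/funext => i; have [<-|ni] := eqVneq n i; last by rewrite ltn_neqAle ni.
    by rewrite ltnn (negbTE zn).
  apply: (Ptrans _ (flip_from n z)); first exact: flipP.
  rewrite (_ : (fun i => _) = flip_from n.+1 (flip_from n z)).
    apply: flipP => i; rewrite ltnS leq_eqVlt => /orP[/eqP->|lin].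
      by rewrite /flip_from leqnn zn.
    by rewrite /flip_from (ltn_geF lin) z0.
  apply/funext => i; rewrite /flip_from; have [<-|ni] := eqVneq n i.
    by rewrite zn ltnn leqnn.
  by rewrite ltn_neqAle ni /z; case: (n <= i)%N; case: (x i).
move=> x y [n xy]; apply: (Ptrans _ _ _ (eraseP n x)).
rewrite (_ : (fun i => _) = (fun i => (n <= i)%N && y i)); first exact/Psym/eraseP.
by apply/funext => i; case: leqP => // /xy.
Qed.

(** * The ternary parametrization of the Cantor set *)

Section CantorMap.
Variable R : realType.
Implicit Types x y : cantor_space.

Definition drop_bits n x : cantor_space := fun i => x (n + i)%N.

(** The partial sums of [\sum_i 2 x_i / 3 ^ i.+1], in Horner form. *)
Fixpoint cantor_approx n x : R :=
  if n is m.+1 then ((x 0%N)%:R *+ 2 + cantor_approx m (drop_bits 1 x)) / 3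
  else 0.

Definition cantor_map x : R := limn (cantor_approx ^~ x).

Lemma cantor_approx_ge0 n x : 0 <= cantor_approx n x.
Proof.
elim: n x => //= n IH x.
by have := IH (drop_bits 1 x); case: (x 0%N) => /=; lra.
Qed.

Lemma cantor_approx_le1 n x : cantor_approx n x <= 1.
Proof.
elim: n x => //= n IH x.
by have := IH (drop_bits 1 x); case: (x 0%N) => /=; lra.
Qed.

Lemma cvg_cantor_map x : cantor_approx ^~ x @ \oo --> cantor_map x.
Proof.
apply: nondecreasing_is_cvgn; last first.
  by exists 1 => _ [n _ <-]; exact: cantor_approx_le1.
apply/nondecreasing_seqP => n; elim: n x => [|n IH] x.
  exact: cantor_approx_ge0.
by have /= := IH (drop_bits 1 x); rewrite ler_pM2r ?invr_gt0// lerD2l.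
Qed.

Lemma cantor_map_ge0 x : 0 <= cantor_map x.
Proof.
apply: limr_ge; first exact: (cvgP _ (@cvg_cantor_map x)).
by near=> n; exact: cantor_approx_ge0.
Unshelve. all: end_near. Qed.

Lemma cantor_map_le1 x : cantor_map x <= 1.
Proof.
apply: limr_le; first exact: (cvgP _ (@cvg_cantor_map x)).
by near=> n; exact: cantor_approx_le1.
Unshelve. all: end_near. Qed.

Lemma cantor_mapE x :
  cantor_map x = ((x 0%N)%:R *+ 2 + cantor_map (drop_bits 1 x)) / 3.
Proof.
apply: (@cvg_unique _ (@Rhausdorff R) ((fun n => cantor_approx n.+1 x) @ \oo)).
  by rewrite /= (cvg_shiftS (cantor_approx ^~ x)); exact: cvg_cantor_map.
by apply: cvgMr_tmp; apply: cvgD; [exact: cvg_cst|exact: cvg_cantor_map].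
Qed.

(** The digits 0 and 2 are exchanged, and [\sum_i 2 / 3 ^ i.+1 = 1]. *)
Lemma cantor_map_flip x : cantor_map (flip_from 0 x) = 1 - cantor_map x.
Proof.
have approx_flip n y :
    cantor_approx n (flip_from 0 y) = 1 - 3^-1 ^+ n - cantor_approx n y.
  elim: n y => [|n IH] y; first by rewrite expr0 subrr subr0.
  rewrite /= -[drop_bits 1 _]/(flip_from 0 (drop_bits 1 y)) IH exprS.
  by rewrite /flip_from; case: (y _) => /=; lra.
apply: (@cvg_unique _ (@Rhausdorff R) (cantor_approx ^~ (flip_from 0 x) @ \oo)).
  exact: cvg_cantor_map.
rewrite (_ : cantor_approx ^~ _ =
    fun n => 1 - 3^-1 ^+ n - cantor_approx n x); last first.
  by apply/funext => n; rewrite approx_flip.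
apply: cvgB; last exact: cvg_cantor_map.
rewrite -[X in _ --> X]subr0; apply: cvgB; first exact: cvg_cst.
by apply: cvg_expr; rewrite ger0_norm ?invr_ge0//; lra.
Qed.

Lemma cantor_map_inj : injective cantor_map.
Proof.
have map_head x y : cantor_map x = cantor_map y ->
    x 0%N = y 0%N /\ cantor_map (drop_bits 1 x) = cantor_map (drop_bits 1 y).
  rewrite (cantor_mapE x) (cantor_mapE y).
  have := cantor_map_ge0 (drop_bits 1 x); have := cantor_map_le1 (drop_bits 1 x).
  have := cantor_map_ge0 (drop_bits 1 y); have := cantor_map_le1 (drop_bits 1 y).
  by case: (x 0%N); case: (y 0%N) => /= *; split; lra.
move=> x y xy; apply/funext => i.
elim: i x y xy => [|i IH] x y /map_head[] // _; exact: IH.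
Qed.

Lemma cantor_map_cylinder n x y :
  cylinder x n y -> `|cantor_map x - cantor_map y| <= 3^-1 ^+ n.
Proof.
elim: n x y => [|n IH] x y xy.
  have := cantor_map_ge0 x; have := cantor_map_le1 x.
  have := cantor_map_ge0 y; have := cantor_map_le1 y.
  by rewrite expr0 ler_norml; lra.
rewrite (cantor_mapE x) (cantor_mapE y) xy// exprS -mulrBl.
rewrite opprD addrACA subrr add0r normrM mulrC.
rewrite (ger0_norm (_ : 0 <= 3^-1)) ?invr_ge0//.
by rewrite ler_pM2l ?invr_gt0 ?ltr0n//; apply: IH => i lin; exact: xy.
Qed.

Lemma cantor_map_continuous : continuous cantor_map.
Proof.
move=> x; apply/cvgrPdist_lt => e e0.
have /cvgrPdist_lt/(_ _ e0) : @GRing.exp R 3^-1 @ \oo --> (0 : R).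
  by apply: cvg_expr; rewrite ger0_norm ?invr_ge0//; lra.
case=> N _ /(_ N (leqnn N)); rewrite sub0r normrN ger0_norm; last first.
  by rewrite exprn_ge0// invr_ge0.
move=> Ne; have xN : nbhs x (cylinder x N).
  by apply: open_nbhs_nbhs; split=> //; exact: open_cylinder.
by apply: filterS xN => y xy; apply: le_lt_trans (cantor_map_cylinder xy) Ne.
Qed.

Lemma cantor_map_ternary x : cantor_ternary (cantor_map x).
Proof.
move=> n _; elim: n x => [|n IH] x.
  by rewrite /= in_itv /= cantor_map_ge0 cantor_map_le1.
rewrite cantor_mapE; case: (x 0%N) => /=.
  by right; exists (cantor_map (drop_bits 1 x)) => //; lra.
by left; exists (cantor_map (drop_bits 1 x)) => //; lra.
Qed.

Lemma cantor_map_drop n x : (forall i, (i < n)%N -> x i = false) ->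
  cantor_map x = cantor_map (drop_bits n x) / 3 ^+ n.
Proof.
elim: n x => [|n IH] x x0; first by rewrite expr0 divr1.
rewrite cantor_mapE x0// mul0rn add0r IH; last by move=> i lin; exact: x0.
rewrite -[drop_bits n _]/(drop_bits n.+1 x) exprSr.
by rewrite invfM mulrA.
Qed.

(** The sequences whose first nonzero entry has index [n] correspond to the part
    of the Cantor set in the interval from [2 / 3 ^ n.+1] to [1 / 3 ^ n], where
    the lower semicircles of index [n.+1] end. *)
Lemma cantor_map_leading n x :
  (forall i, (i < n)%N -> x i = false) -> x n ->
  cantor_map x = (2 + cantor_map (drop_bits n.+1 x)) / 3 ^+ n.+1.
Proof.
move=> x0 xn; rewrite (cantor_map_drop x0) cantor_mapE.
have -> : drop_bits 1 (drop_bits n x) = drop_bits n.+1 x.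
  by apply/funext => i; rewrite /drop_bits addnA addn1.
by rewrite {1}/drop_bits addn0 xn exprS invfM mulrA.
Qed.

Lemma cantor_map_flip_leading n x :
  (forall i, (i < n)%N -> x i = false) -> x n ->
  cantor_map (flip_from n.+1 x) = 5 / 3 ^+ n.+1 - cantor_map x.
Proof.
move=> x0 xn; rewrite (cantor_map_leading x0 xn) (@cantor_map_leading n); first last.
- by rewrite /flip_from ltnn addbF.
- by move=> i lin; rewrite /flip_from x0// (leq_gtF (ltnW lin)).
have -> : drop_bits n.+1 (flip_from n.+1 x) = flip_from 0 (drop_bits n.+1 x).
  by apply/funext => i; rewrite /drop_bits /flip_from leq_addr.
by rewrite cantor_map_flip; lra.
Qed.

End CantorMap.

(** * Ultrafilter orders and connected sets *)

Section ChainOrder.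
Context {R : realType} {X : topologicalType}.
Implicit Types (A : set X) (d : X -> X -> R).

Lemma compatible_metric_hausdorff d : compatible_metric d -> hausdorff_space X.
Proof.
move=> [[dge0 d0 dsym dtri] dtop]; rewrite open_hausdorff => x y /eqP xy.
have dxy : 0 < d x y by rewrite lt_def dge0 andbT; apply/eqP => /d0.
pose B z : set X := [set w | d z w < d x y / 2].
have oB z : open (B z).
  apply/dtop => w /= zw; exists (d x y / 2 - d z w); first by rewrite subr_gt0.
  by move=> v wv; apply: le_lt_trans (dtri _ w _) _; rewrite -ltrBrDl.
exists (B x, B y) => /=.
  by rewrite !inE /B /= (d0 x x).2// (d0 y y).2// divr_gt0.
split=> //; apply/eqP/seteqP; split=> // z [xz yz]; rewrite /B /= in xz yz; exfalso.
by have := dtri x z y; rewrite (dsym z y); lra.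
Qed.

Lemma mesh_small d (k : nat -> nat) (D : forall n, 'I_(k n) -> set X) (e : R) :
  mesh d (D n) @[n --> \oo] --> 0%E -> 0 < e ->
  exists N, forall n, (N <= n)%N ->
    forall i x y, D n i x -> D n i y -> d x y < e.
Proof.
move=> /(_ [set z | (z < e%:E)%E]) mesh0 e0.
have [|N _ Ne] := mesh0.
  by apply: open_nbhs_nbhs; split; [exact: open_ereal_lt_ereal|rewrite /= lte_fin].
exists N => n Nn i x y Dx Dy; rewrite -lte_fin; apply: le_lt_trans (Ne n Nn).
rewrite /mesh; apply: le_trans (le_bigmax _ _ i).
by apply: ereal_sup_ubound; exists (x, y).
Qed.

(** Removing the [j]-th link separates the links before it from those after
    it. *)
Lemma chain_cut k (D : 'I_k -> set X) A (i j l : 'I_k) p q :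
  is_chain D -> covers D -> connected A -> A `&` D j `<=` set0 ->
  A p -> D i p -> (i < j)%N -> A q -> D l q -> (l < j)%N.
Proof.
move=> [oD adjD] cD cA Aj Ap Dp ij Aq Dq.
pose E := \bigcup_(m in [set m : 'I_k | (m < j)%N]) D m.
pose F := \bigcup_(m in [set m : 'I_k | (j < m)%N]) D m.
have EF z : E z -> F z -> False.
  move=> [m /= mj mz] [m' /= jm' m'z].
  have /adjD : D m `&` D m' !=set0 by exists z.
  by lia.
have AEF z : A z -> E z \/ F z.
  move=> Az; have [m _ mz] : (\bigcup_i D i) z by rewrite cD.
  have [mj|jm|mj] := ltngtP m j; [by left; exists m|by right; exists m|].
  by case: (Aj z); split=> //; rewrite -(ord_inj mj).
have AE : A `&` E = A.
  apply: cA; first by exists p; split=> //; exists i.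
    by exists E => //; exact: bigcup_open.
  exists (~` F); first by apply: open_closedC; exact: bigcup_open.
  apply/seteqP; split=> z [Az]; first by move=> Ez; split=> // /(EF _ Ez).
  by move=> nFz; split=> //; case: (AEF _ Az).
have [_ Eq] : (A `&` E) q by rewrite AE.
rewrite ltnNge leq_eqVlt; apply/negP => /orP[/eqP jl|jl].
  by case: (Aj q); split=> //; rewrite (ord_inj jl).
by apply: (EF q) => //; exists l.
Qed.

Lemma nonprincipal_tail (U : set_system nat) N :
  UltraFilter U -> nonprincipal U -> U [set n | (N <= n)%N].
Proof.
move=> UU npU; case: (in_ultra_setVsetC [set n | (N <= n)%N] UU) => // UN.
exfalso; elim: N UN => [|N IH] UN.
  by apply: (filter_not_empty U); apply: filterS UN => n /(_ isT).
apply: IH; case: (in_ultra_setVsetC [set N] UU) => [/npU//|UnN].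
apply: filterS (filterI UN UnN) => n [/= /negP nN nN'] /= Nn; apply: nN'.
by apply/eqP; rewrite eqn_leq Nn andbT; move: nN; rewrite -ltnNge.
Qed.

Section UltraOrder.
Context (d : X -> X -> R) (k : nat -> nat) (D : forall n, 'I_(k n) -> set X)
  (U : set_system nat).
Hypotheses (cd : compatible_metric d)
  (chD : forall n, is_chain (@D n) /\ covers (@D n))
  (mesh0 : mesh d (@D n) @[n --> \oo] --> 0%E)
  (UU : UltraFilter U) (npU : nonprincipal U).

Lemma ultra_le_total x y : ultra_le (@D) U x y \/ ultra_le (@D) U y x.
Proof.
have [|nxy] := in_ultra_setVsetC [set n | chain_le (@D n) x y] UU; first by left.
right; apply: filterS nxy => n nxy.
have [i _ ix] : (\bigcup_i @D n i) x by rewrite (chD n).2.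
have [j _ jy] : (\bigcup_i @D n i) y by rewrite (chD n).2.
exists j, i; split=> //; rewrite leqNgt; apply/negP => ij.
by apply: nxy; exists i, j; rewrite ltnW.
Qed.

(** Two points that precede each other lie in one link or in two adjacent
    ones, at every level of small mesh. *)
Lemma ultra_le_antisym x y : ultra_le (@D) U x y -> ultra_le (@D) U y x -> x = y.
Proof.
have [[dge0 d0 dsym dtri] _] := cd.
move=> xy yx; apply/d0/eqP; rewrite eq_le dge0 andbT leNgt; apply/negP => dxy.
(* the path from [x] to [y] through a common point of two adjacent links has
   length twice the mesh, whence the factor 2 *)
have [N smallN] := mesh_small mesh0 (divr_gt0 dxy (ltr0n _ 2)).
have UN := nonprincipal_tail N UU npU.
have [n [[[i [j [ij ix jy]]] [i' [j' [ij' iy jx]]]] Nn]] :=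
  filter_ex (filterI (filterI xy yx) UN).
have small := smallN n Nn; have [_ adjD] := (chD n).1.
have close (a b : 'I_(k n)) : @D n a x -> @D n b y -> ~ (`|a%:Z - b%:Z| <= 1)%N.
  move=> ax yb /adjD[z [az bz]].
  have := dtri x z y; have := small _ _ _ ax az; have := small _ _ _ bz yb; lra.
have := close _ _ ix jy; have := close _ _ jx iy.
have /adjD : @D n i `&` @D n j' !=set0 by exists x.
have /adjD : @D n j `&` @D n i' !=set0 by exists y.
by lia.
Qed.

(** For large [n], no link around [y] meets the closed set [A], so [A] lies
    entirely before or entirely after [y]. *)
Lemma ultra_le_connected A p q y : connected A -> closed A -> A p -> A q ->
  ~ A y -> (ultra_le (@D) U p y -> ultra_le (@D) U q y) /\
           (ultra_le (@D) U y p -> ultra_le (@D) U y q).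
Proof.
move=> cA clA Ap Aq nAy; have [_ dtop] := cd.
have /dtop/(_ _ nAy)[e e0 eA] : open (~` A) by exact: closed_openC.
have [N smallN] := mesh_small mesh0 e0.
have UN := nonprincipal_tail N UU npU.
have miss n j : (N <= n)%N -> @D n j y -> A `&` @D n j `<=` set0.
  by move=> Nn jy z [Az jz]; exact: (eA z (smallN n Nn j y z jy jz)).
have neq n j m z : (N <= n)%N -> @D n j y -> A z -> @D n m z -> m <> j.
  by move=> Nn jy Az mz mj; apply: (miss n j Nn jy z); rewrite -mj.
have link n z : exists m, @D n m z.
  have [m _ mz] : (\bigcup_i @D n i) z by rewrite (chD n).2.
  by exists m.
split=> le; apply: filterS (filterI le UN) => n [[i [j [ij Di Dj]]] Nn];
  have [l lq] := link n q; have [ch co] := chD n.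
- exists l, j; split=> //; apply: ltnW.
  apply: (chain_cut ch co cA (miss n j Nn Dj) Ap Di _ Aq lq).
  by rewrite ltn_neqAle ij andbT; apply/eqP => /ord_inj; exact: neq Dj Ap Di.
- exists i, l; split=> //; rewrite leqNgt; apply/negP => li.
  have := chain_cut ch co cA (miss n i Nn Di) Aq lq li Ap Dj.
  by rewrite ltnNge ij.
Qed.

End UltraOrder.
End ChainOrder.

(** * Arcs of the Knaster continuum *)

Section KnasterArcs.
Variable R : realType.
Implicit Types x y : cantor_space.

Lemma knaster_set_axis (c : R) : cantor_ternary c -> knaster_set (c, 0).
Proof. by move=> Cc; left; exists c => //; split=> //=; rewrite expr0n addr0. Qed.

Definition knaster_point x : knaster R :=
  exist _ (cantor_map R x, 0) (mem_set (knaster_set_axis (cantor_map_ternary R x))).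

Lemma knaster_lift_continuous (T : topologicalType) (f : T -> knaster R) :
  continuous (fun t => (set_val (f t)).1) ->
  continuous (fun t => (set_val (f t)).2) -> continuous f.
Proof.
move=> f1 f2; apply: continuous_comp_initial => t.
rewrite (_ : set_val \o f =
    fun t => ((set_val (f t)).1, (set_val (f t)).2)); last first.
  by apply/funext => s /=; case: (set_val _).
exact: cvg_pair (f1 t) (f2 t).
Qed.

Lemma knaster_point_continuous : continuous knaster_point.
Proof.
apply: knaster_lift_continuous => /=; first exact: cantor_map_continuous.
by move=> x; exact: cvg_cst.
Qed.

(** A semicircle with center [(a, 0)] and radius [r] is traced by
    [(a + r cos t, s |r sin t|)], where [s] is [1] or [-1]. *)
Lemma semicircle_arc (a r s : R) : s ^+ 2 = 1 ->
  (forall p : R * R, 0 <= s * p.2 -> (p.1 - a) ^+ 2 + p.2 ^+ 2 = r ^+ 2 ->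
     knaster_set p) ->
  exists A : set (knaster R), [/\ connected A, compact A,
    forall p : knaster R, set_val p = (a + r, 0) \/ set_val p = (a - r, 0) -> A p &
    forall p : knaster R, A p -> (set_val p).2 = 0 ->
      (set_val p).1 = a + r \/ (set_val p).1 = a - r].
Proof.
move=> s1 sub.
pose g t : R * R := (a + r * cos t, s * `|r * sin t|).
have gK t : knaster_set (g t).
  apply: sub => /=; first by rewrite mulrA -expr2 s1 mul1r.
  rewrite exprMn s1 mul1r real_normK ?num_real// addrAC subrr add0r.
  by rewrite !exprMn -mulrDr cos2Dsin2 mulr1.
pose f t : knaster R := exist _ (g t) (mem_set (gK t)).
have cf : continuous f.
  apply: knaster_lift_continuous => t /=.
    apply: cvgD; first exact: cvg_cst.
    by apply: cvgMl_tmp; exact: continuous_cos.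
  apply: cvgMl_tmp; apply: (@cvg_norm); apply: cvgMl_tmp; exact: continuous_sin.
exists (f @` `[0, pi]); split.
- apply: connected_continuous_connected; first exact: segment_connected.
  exact: continuous_subspaceT.
- apply: continuous_compact; last exact: segment_compact.
  exact: continuous_subspaceT.
- move=> p; have pi0 := pi_ge0 R; case=> pE; [exists 0|exists pi] => /=;
    rewrite ?in_itv /= ?lexx ?pi0//; apply: val_inj; rewrite /= [RHS]pE /g.
    by rewrite cos0 sin0 mulr0 mulr1 normr0 mulr0.
  by rewrite cospi sinpi mulr0 mulrN1 normr0 mulr0.
- move=> _ [t _ <-] /= /eqP; rewrite mulf_eq0 normr_eq0 => /orP[/eqP s0|/eqP rs0].
    by move: s1; rewrite s0 expr0n /= => /esym/eqP; rewrite oner_eq0.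
  have : (r * cos t) ^+ 2 = r ^+ 2.
    rewrite -[RHS]mulr1 -(cos2Dsin2 t) mulrDr -!exprMn rs0 expr0n addr0.
    by rewrite exprMn.
  by move/eqP; rewrite eqf_sqr => /orP[]/eqP ->; [left|right].
Qed.

(** The last clause makes [A] avoid every point of the Cantor set outside the
    tail class of [x], so that the order of such a point relative to [x] and to
    [y] is the same. *)
Definition arc_linked x y := exists A : set (knaster R),
  [/\ connected A, compact A, A (knaster_point x), A (knaster_point y) &
    forall z, A (knaster_point z) -> tail_class x z].

Lemma arc_linked_tail_class x y : arc_linked x y -> tail_class x y.
Proof. by move=> [A [_ _ _ Ay]]; apply. Qed.

Lemma knaster_point_inj : injective knaster_point.
Proof. by move=> x y [/cantor_map_inj]. Qed.

Lemma arc_linked_refl x : arc_linked x x.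
Proof.
exists [set knaster_point x]; split=> //; [exact: connected1|exact: compact_set1|].
by move=> z /knaster_point_inj ->; exact: tail_class_refl.
Qed.

Lemma arc_linked_sym x y : arc_linked x y -> arc_linked y x.
Proof.
move=> xy; have [A [cA kA Ax Ay AT]] := xy; exists A; split=> // z /AT.
exact/tail_class_trans/tail_class_sym/arc_linked_tail_class.
Qed.

Lemma arc_linked_trans x y z : arc_linked x y -> arc_linked y z -> arc_linked x z.
Proof.
move=> xy; have [A [cA kA Ax Ay AT]] := xy; move=> [B [cB kB By Bz BT]].
exists (A `|` B); split; [|exact: compactU|by left|by right|].
  by apply: connectedU => //; exists (knaster_point y).
move=> w [/AT//|/BT]; exact/tail_class_trans/arc_linked_tail_class.
Qed.

(** A semicircle meets the axis in two points only, symmetric about its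
    center. *)
Lemma semicircle_linked (a s : R) x y : s ^+ 2 = 1 ->
  (forall p : R * R, 0 <= s * p.2 ->
     (p.1 - a) ^+ 2 + p.2 ^+ 2 = (cantor_map R x - a) ^+ 2 -> knaster_set p) ->
  cantor_map R y = a *+ 2 - cantor_map R x -> tail_class x y ->
  arc_linked x y.
Proof.
move=> s1 sub yE xy; have [A [cA kA Aends Aaxis]] := semicircle_arc s1 sub.
have E1 : a + (cantor_map R x - a) = cantor_map R x by rewrite addrC subrK.
have E2 : a - (cantor_map R x - a) = cantor_map R y.
  by rewrite yE opprB addrA -mulr2n.
exists A; split=> //.
- by apply: Aends; left; rewrite E1.
- by apply: Aends; right; rewrite E2.
- move=> z /Aaxis/(_ erefl) /=; rewrite E1 E2 => -[]/cantor_map_inj -> //.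
  exact: tail_class_refl.
Qed.

Lemma arc_linked_upper x : arc_linked x (flip_from 0 x).
Proof.
apply: (@semicircle_linked (1 / 2) 1); first by rewrite expr1n.
- move=> p; rewrite mul1r => p2 pE; left.
  by exists (cantor_map R x) => //; exact: cantor_map_ternary.
- by rewrite cantor_map_flip; lra.
- exact: tail_class_flip.
Qed.

Lemma arc_linked_lower x n : (forall i, (i < n)%N -> x i = false) -> x n ->
  arc_linked x (flip_from n.+1 x).
Proof.
move=> x0 xn; have e0 : 0 < (3 ^+ n : R) by rewrite exprn_gt0.
apply: (@semicircle_linked (5 / (2 * 3 ^+ n.+1)) (-1)); first by rewrite sqrrN expr1n.
- move=> p; rewrite mulN1r oppr_ge0 => p2 pE; right; exists n.+1 => //.
  exists (cantor_map R x) => //; split; first exact: cantor_map_ternary.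
  rewrite /= in_itv /= (cantor_map_leading R x0 xn).
  have := cantor_map_ge0 R (drop_bits n.+1 x).
  have := cantor_map_le1 R (drop_bits n.+1 x).
  move=> le1 ge0; apply/andP; split.
    by rewrite ler_pM2r ?invr_gt0 ?exprn_gt0//; lra.
  by rewrite ler_pdivrMr ?exprn_gt0// exprS div1r mulrCA mulVf ?gt_eqF//; lra.
- rewrite (cantor_map_flip_leading R x0 xn); congr (_ - _).
  by rewrite invfM mulrA -mulrnAl; congr (_ / _); lra.
- exact: tail_class_flip.
Qed.

Lemma eventually_equal_arc_linked x y : eventually_equal x y -> arc_linked x y.
Proof.
apply: flips_eventually_equal; [exact: arc_linked_refl|exact: arc_linked_sym|
  exact: arc_linked_trans|exact: arc_linked_upper|exact: arc_linked_lower].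
Qed.

End KnasterArcs.

(** * Tail-invariant linear orders *)

(** The square of the Cantor space is coded by the Cantor space itself: [z]
    stands for the pair [(evens z, odds z)]. *)
Definition evens (z : cantor_space) : cantor_space := fun i => z i.*2.
Definition odds (z : cantor_space) : cantor_space := fun i => z i.*2.+1.

Definition swap_halves (z : cantor_space) : cantor_space :=
  fun i => if odd i then z i.-1 else z i.+1.

Lemma evens_continuous : continuous evens.
Proof.
apply: continuous_cylinder => x n; exists n.*2 => z zx i lin.
by rewrite /evens zx// ltn_double.
Qed.

Lemma odds_continuous : continuous odds.
Proof.
apply: continuous_cylinder => x n; exists n.*2 => z zx i lin.
by rewrite /odds zx// ltn_Sdouble.
Qed.

Lemma swap_halves_continuous : continuous swap_halves.
Proof.
apply: continuous_cylinder => x n; exists n.+1 => z zx i lin.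
by rewrite /swap_halves !zx//; lia.
Qed.

Lemma swap_halvesK : involutive swap_halves.
Proof.
move=> z; apply/funext => -[|i] //; rewrite /swap_halves /=.
by case oi: (odd i); rewrite /= ?oi.
Qed.

Lemma evens_swap z : evens (swap_halves z) = odds z.
Proof. by apply/funext => i; rewrite /evens /swap_halves odd_double. Qed.

Lemma odds_swap z : odds (swap_halves z) = evens z.
Proof. by apply/funext => i; rewrite /odds /swap_halves /= odd_double. Qed.

Lemma eventually_equal_halves z w : eventually_equal z w ->
  eventually_equal (evens z) (evens w) /\ eventually_equal (odds z) (odds w).
Proof.
move=> [n zw]; split; exists n => i ni; apply: zw; lia.
Qed.

(** For a fixed place and a fixed parity, agreement of the tails is a closed
    condition that a change of one entry destroys. *)
Lemma meager_tail_class : meager [set z | tail_class (evens z) (odds z)].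
Proof.
apply: sub_meager (meager_bigcup (A := fun nb : nat * bool => [set z |
  forall i, (nb.1 <= i)%N -> evens z i = nb.2 (+) odds z i]) _).
  by move=> z [n [b zP]]; exists (n, b).
move=> [n b]; apply: nowhere_dense_meager => V oV [x Vx] /=.
have [m mV] : exists m, cylinder x m `<=` V.
  by apply: nbhs_cylinder; exact: open_nbhs_nbhs.
pose k := maxn m n.
(* the entry of index [2 k] is chosen so as to violate the relation there *)
pose w : cantor_space := fun i =>
  if i == k.*2 then ~~ (b (+) x k.*2.+1) else x i.
exists (cylinder w k.+1.*2); split; [exact: open_cylinder|by exists w| |].
- move=> z zw; apply: mV => i im; rewrite zw; last by lia.
  by rewrite /w ifF//; apply/eqP; lia.
- move=> z [zw /(_ k)]; rewrite /evens /odds !zw; try lia.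
  rewrite /w eqxx ifF; last by apply/eqP; lia.
  by move=> /(_ (leq_maxr _ _)) /eqP; case: (_ (+) _).
Qed.

(** By the zero-one law such a relation, as a set of pairs and up to the meager
    set of pairs in one tail class, is meager or comeager.  Exchanging the coordinates preserves both, whereas [L] and its
    converse cover the plane and meet on the diagonal only. *)
Lemma tail_invariant_order_not_baire (L : cantor_space -> cantor_space -> Prop) :
  (forall x y, L x y \/ L y x) -> (forall x y, L x y -> L y x -> x = y) ->
  (forall x x' y, eventually_equal x x' -> ~ tail_class x y ->
     (L x y -> L x' y) /\ (L y x -> L y x')) ->
  ~ baire_property [set z | L (evens z) (odds z)].
Proof.
move=> Ltotal Lasym Linv bL.
pose M := [set z | L (evens z) (odds z)].
pose E := [set z | tail_class (evens z) (odds z)].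
have mswap A : meager A -> meager (swap_halves @^-1` A).
  by apply: preimage_involution_meager;
    [exact: swap_halves_continuous|exact: swap_halvesK].
have [||mA|mA] := @zero_one_law (M `&` ~` E).
- apply: baire_propertyI => //.
  exact/baire_propertyC/baire_property_meager/meager_tail_class.
- move=> z w zw [Lz nEz]; have [zwe zwo] := eventually_equal_halves zw.
  have Le := (Linv _ _ _ zwe nEz).1 Lz.
  have Ee : ~ tail_class (evens w) (odds z).
    move=> T; apply: nEz; apply: tail_class_trans T.
    exact: eventually_equal_tail_class.
  split; first by apply: (Linv _ _ _ zwo _).2 => // /tail_class_sym.
  move=> T; apply: Ee; apply: tail_class_trans T _.
  exact/tail_class_sym/eventually_equal_tail_class.
- have mM : meager M.
    apply: sub_meager (meagerU mA meager_tail_class) => z Mz.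
    by have [Ez|nEz] := pselect (E z); [right|left].
  apply: cantor_not_meager; apply: sub_meager (meagerU mM (mswap _ mM)) => z _.
  have [Lz|Lz] := Ltotal (evens z) (odds z); [by left|right].
  by rewrite /M /= evens_swap odds_swap.
- apply: cantor_not_meager.
  apply: sub_meager (meagerU mA (mswap _ mA)) => z _.
  have [[Mz nEz]|] := pselect ((M `&` ~` E) z); [right|by left].
  move=> [Mz' _]; apply: nEz; rewrite /M /= evens_swap odds_swap in Mz'.
  by rewrite /E /= (Lasym _ _ Mz Mz'); exact: tail_class_refl.
Qed.

(** * Ultrafilter orders on the Knaster continuum *)

Lemma hausdorff_prod (S T : topologicalType) :
  hausdorff_space S -> hausdorff_space T -> hausdorff_space (S * T)%type.
Proof.
rewrite !open_hausdorff => hS hT [x y] [x' y'] xy.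
have [xx'|yy'] : x != x' \/ y != y'.
- by apply/orP; move: xy; rewrite xpair_eqE negb_and.
- have [[A B] /= [/set_mem Ax /set_mem Bx'] [oA oB /eqP AB0]] := hS _ _ xx'.
  exists (fst @^-1` A, fst @^-1` B) => /=; first by rewrite !inE.
  split; [by apply: open_comp => // ? _; exact: cvg_fst|
    by apply: open_comp => // ? _; exact: cvg_fst|].
  by rewrite -preimage_setI AB0 preimage_set0.
- have [[A B] /= [/set_mem Ay /set_mem By'] [oA oB /eqP AB0]] := hT _ _ yy'.
  exists (snd @^-1` A, snd @^-1` B) => /=; first by rewrite !inE.
  split; [by apply: open_comp => // ? _; exact: cvg_snd|
    by apply: open_comp => // ? _; exact: cvg_snd|].
  by rewrite -preimage_setI AB0 preimage_set0.
Qed.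

Section KnasterOrder.
Variable R : realType.

Definition knaster_pair (z : cantor_space) : (knaster R * knaster R)%type :=
  (knaster_point R (evens z), knaster_point R (odds z)).

Lemma knaster_pair_continuous : continuous knaster_pair.
Proof.
have kc := @knaster_point_continuous R.
move=> z; exact: cvg_pair
  (continuous_comp (evens_continuous (x := z)) (kc (evens z)))
  (continuous_comp (odds_continuous (x := z)) (kc (odds z))).
Qed.

Lemma knaster_order_not_baire (d : knaster R -> knaster R -> R)
    (le : knaster R -> knaster R -> Prop) :
  compatible_metric d -> ultrafilter_order d le ->
  ~ baire_property (knaster_pair @^-1` [set p | le p.1 p.2]).
Proof.
move=> cd [k [D [U [chD mesh0 UU npU leE]]]].
apply: (@tail_invariant_order_not_baire
  (fun x y => le (knaster_point R x) (knaster_point R y))).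
- by move=> x y; rewrite !leE; exact: ultra_le_total.
- move=> x y; rewrite !leE => xy yx.
  exact/(@knaster_point_inj R)/(ultra_le_antisym cd chD mesh0).
- move=> x x' y /(eventually_equal_arc_linked R) [A [cA kA Ax Ax' AT]] nT.
  rewrite !leE; apply: (ultra_le_connected cd chD mesh0 UU npU cA) => //.
    by apply: compact_closed => //; exact: compatible_metric_hausdorff cd.
  by move=> /AT.
Qed.

End KnasterOrder.

Theorem theorem7p6 (R : realType) (d : knaster R -> knaster R -> R)
    (hd : compatible_metric d)
    (le : knaster R -> knaster R -> Prop)
    (hle : ultrafilter_order d le) :
  let M : set (knaster R * knaster R)%type := [set p | le p.1 p.2] in
  (~ analytic R M /\ ~ coanalytic R M) /\ ~ borel_set M.
Proof.
move=> M; have nbM := knaster_order_not_baire hd hle.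
have hK : hausdorff_space (knaster R * knaster R)%type.
  by apply: hausdorff_prod; exact: compatible_metric_hausdorff hd.
have analytic_baire A : analytic R A -> baire_property (@knaster_pair R @^-1` A).
  apply: analytic_preimage_baire_property => //.
    exact: cantor_second_countable.
  exact: knaster_pair_continuous.
split; first split.
- by move=> /analytic_baire.
- move=> /analytic_baire/baire_propertyC.
  by rewrite preimage_setC setCK.
- move=> bM; apply: nbM; apply: borel_preimage_baire_property bM.
  exact: knaster_pair_continuous.
Qed.
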